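(* Let $A=\{a_1,\dots,a_n\}$ be an orthonormal basis of $V_A=\mathbb{R}^n$, let $S$ be a two-dimensional real vector space with basis $\{\top,\bot\}$, and suppose the non-empty sets $C_1,\dots,C_k$ partition $A$, with $m_j=|C_j|$. Let $C=\{c_1,\dots,c_k\}$ be an orthonormal basis of $V_C=\mathbb{R}^k$ and for a predicate $p$ on $A$ define $\mathcal{J}_C(p)=\sum_{j=1}^k (n_{pC_j}/m_j)\,c_j$, where $n_{pC_j}$ is the number of $a\in C_j$ with $p(a)=\top$. Let $p,q$ be predicates on $A$ and let $\vec 1=\sum_{j=1}^k c_j$. Then: (1) $\mathcal{J}_C(\mathrm{not}\circ p)=\neg\mathcal{J}_C(p)$. (2) If $\mathcal{J}_C(p)\rightarrow\mathcal{J}_C(q)=\vec 1$, then $\mathrm{ifthen}\circ\langle p,q\rangle=\mathrm{true}$. (3) If one of $\mathcal{J}_C(q)$, $\mathcal{J}_C(p)$ is an algebraic consequence of the other (i.e. $\mathcal{J}_C(p)\rightarrow\mathcal{J}_C(q)=\vec 1$ or $\mathcal{J}_C(q)\rightarrow\mathcal{J}_C(p)=\vec 1$), then $\mathcal{J}_C(p)\wedge\mathcal{J}_C(q)=\mathcal{J}_C(\mathrm{and}\circ\langle p,q\rangle)$, $\mathcal{J}_C(p)\vee\mathcal{J}_C(q)=\mathcal{J}_C(\mathrm{or}\circ\langle p,q\rangle)$, $\mathcal{J}_C(p)\rightarrow\mathcal{J}_C(q)=\mathcal{J}_C(\mathrm{ifthen}\circ\langle p,q\rangle)$, and $\mathcal{J}_C(q)\rightarrow\mathcal{J}_C(p)=\mathcal{J}_C(\mathrm{ifthen}\circ\langle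 q,p\rangle)$.
   Context: A predicate on $A$ is a linear map $p:V_A\to S$ with $p(a)\in\{\top,\bot\}$ for every $a\in A$; $\mathrm{true}:V_A\to S$ is the predicate with $\mathrm{true}(a_i)=\top$ for all $i$. The logical connectives are the linear maps $\mathrm{not}:S\to S$ with $\mathrm{not}(\top)=\bot$, $\mathrm{not}(\bot)=\top$, and $\mathrm{and},\mathrm{or},\mathrm{ifthen}:S\otimes S\to S$ given on basis vectors by: $\mathrm{and}(z)=\top$ iff $z=\top\otimes\top$, else $\bot$; $\mathrm{or}(z)=\bot$ iff $z=\bot\otimes\bot$, else $\top$; $\mathrm{ifthen}(z)=\bot$ iff $z=\top\otimes\bot$, else $\top$. With $d_A:V_A\to V_A\otimes V_A$ the linear map $d_A(a_i)=a_i\otimes a_i$, set $\langle p,q\rangle=(p\otimes q)\circ d_A$. The algebraic connectives on scalars are $\neg\alpha=1-\alpha$, $\alpha\wedge\beta=\alpha\beta$, $\alpha\vee\beta=\alpha+\beta-\alpha\beta$, $\alpha\rightarrow\beta=1-\alpha+\alpha\beta$, applied to vectors of $V_C$ coordinatewise with respect to $C$. A vector $Y$ is an algebraic consequence of $X$ if $X\rightarrow Y=\vec 1$. *)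

(* Defs.v *)
From HB Require Import structures.
From mathcomp Require Import all_boot all_order all_algebra.
From mathcomp Require Import reals.

Set Implicit Arguments.
Unset Strict Implicit.
Unset Printing Implicit Defensive.

Import Order.TTheory GRing.Theory Num.Theory.
Local Open Scope ring_scope.

Definition lin_ext_fun (K : fieldType) (V W : vectType K) (n : nat)
    (b : n.-tuple V) (y : 'I_n -> W) (v : V) : W :=
  \sum_(i < n) coord b i v *: y i.

Fact lin_ext_fun_is_linear (K : fieldType) (V W : vectType K) (n : nat)
  (b : n.-tuple V) (y : 'I_n -> W) : linear (lin_ext_fun b y).
Proof.
move=> s u v; rewrite /lin_ext_fun scaler_sumr -big_split /=.
by apply: eq_bigr => i _; rewrite linearP /= scalerDl scalerA.
Qed.

HB.instance Definition _ (K : fieldType) (V W : vectType K) (n : nat)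
    (b : n.-tuple V) (y : 'I_n -> W) :=
  GRing.isLinear.Build K V W *:%R (lin_ext_fun b y)
    (lin_ext_fun_is_linear b y).

(* The linear map sending the i-th vector of the basis b to y i. *)
Definition lin_ext (K : fieldType) (V W : vectType K) (n : nat)
    (b : n.-tuple V) (y : 'I_n -> W) : 'Hom(V, W) :=
  linfun (lin_ext_fun b y).

Lemma lin_extE (K : fieldType) (V W : vectType K) (n : nat)
    (b : n.-tuple V) (y : 'I_n -> W) (i : 'I_n) :
  free b -> lin_ext b y b`_i = y i.
Proof.
move=> bfree; rewrite lfunE /= /lin_ext_fun (bigD1 i) //= coord_free // eqxx.
rewrite scale1r big1 ?addr0 // => j /negPf ji.
by rewrite coord_free // eq_sym ji scale0r.
Qed.

(* Tensor products of finite-dimensional spaces, modelled on coordinate      *)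
(* matrices in the reference bases vbasis; the lemmas up to tens_lift_unique *)
(* are bilinearity of tens and the universal property.                       *)
Notation tensor V W := 'M_(\dim {: V}, \dim {: W}).

Definition tens (K : fieldType) (V W : vectType K) (v : V) (w : W) :
    'M[K]_(\dim {: V}, \dim {: W}) :=
  \matrix_(i, j) (coord (vbasis fullv) i v * coord (vbasis fullv) j w).

Lemma tens_linearl (K : fieldType) (V W : vectType K) (w : W) :
  linear (fun v : V => tens v w).
Proof.
by move=> s u v; apply/matrixP=> i j; rewrite !mxE linearP /= mulrDl mulrA.
Qed.

Lemma tens_linearr (K : fieldType) (V W : vectType K) (v : V) :
  linear (fun w : W => tens v w).
Proof.
move=> s u w; apply/matrixP=> i j.
by rewrite !mxE linearP /= mulrDr mulrCA.
Qed.

Definition tens_lift_fun (K : fieldType) (V W U : vectType K)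
    (beta : V -> W -> U) (X : 'M[K]_(\dim {: V}, \dim {: W})) : U :=
  \sum_i \sum_j X i j *: beta (vbasis fullv)`_i (vbasis fullv)`_j.

Fact tens_lift_fun_is_linear (K : fieldType) (V W U : vectType K)
  (beta : V -> W -> U) : linear (tens_lift_fun beta).
Proof.
move=> s X Y; rewrite /tens_lift_fun scaler_sumr -big_split /=.
apply: eq_bigr => i _; rewrite scaler_sumr -big_split /=.
by apply: eq_bigr => j _; rewrite !mxE scalerDl scalerA.
Qed.

HB.instance Definition _ (K : fieldType) (V W U : vectType K)
    (beta : V -> W -> U) :=
  GRing.isLinear.Build K (tensor V W) U *:%R (tens_lift_fun beta)
    (tens_lift_fun_is_linear beta).

(* The linear map on the tensor product induced by the bilinear map beta. *)
Definition tens_lift (K : fieldType) (V W U : vectType K)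
    (beta : V -> W -> U) : 'Hom(tensor V W, U) :=
  linfun (tens_lift_fun beta).

Lemma tens_liftE (K : fieldType) (V W U : vectType K) (beta : V -> W -> U) :
    (forall w, linear (beta^~ w)) -> (forall v, linear (beta v)) ->
  forall v w, tens_lift beta (tens v w) = beta v w.
Proof.
move=> linl linr v w; rewrite lfunE /= /tens_lift_fun.
have suml w' n (k : 'I_n -> K) (x : 'I_n -> V) :
    beta (\sum_i k i *: x i) w' = \sum_i k i *: beta (x i) w'.
  have b0 : beta 0 w' = 0.
    by have := linl w' (-1) 0 0; rewrite scaleN1r addNr scaleN1r addNr.
  have bD : {morph beta^~ w' : y1 y2 / y1 + y2}.
    by move=> y1 y2; have := linl w' 1 y1 y2; rewrite !scale1r.
  rewrite (big_morph _ bD b0); apply: eq_bigr => i _.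
  by have := linl w' (k i) (x i) 0; rewrite b0 !addr0.
have sumr v' n (k : 'I_n -> K) (x : 'I_n -> W) :
    beta v' (\sum_i k i *: x i) = \sum_i k i *: beta v' (x i).
  have b0 : beta v' 0 = 0.
    by have := linr v' (-1) 0 0; rewrite scaleN1r addNr scaleN1r addNr.
  have bD : {morph beta v' : y1 y2 / y1 + y2}.
    by move=> y1 y2; have := linr v' 1 y1 y2; rewrite !scale1r.
  rewrite (big_morph _ bD b0); apply: eq_bigr => i _.
  by have := linr v' (k i) (x i) 0; rewrite b0 !addr0.
rewrite [in RHS](coord_vbasis (memvf v)) suml; apply: eq_bigr => i _.
rewrite [in RHS](coord_vbasis (memvf w)) sumr scaler_sumr.
by apply: eq_bigr => j _; rewrite mxE scalerA.
Qed.

Lemma tens_lift_unique (K : fieldType) (V W U : vectType K)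
    (f g : 'Hom(tensor V W, U)) :
  (forall v w, f (tens v w) = g (tens v w)) -> f = g.
Proof.
move=> fg; apply/lfunP => X; rewrite [X]matrix_sum_delta !linear_sum /=.
apply: eq_bigr => i _; rewrite !linear_sum /=; apply: eq_bigr => j _.
rewrite !linearZ /=; congr (_ *: _).
suff -> : delta_mx i j = tens (vbasis {:V})`_i (vbasis {:W})`_j by [].
apply/matrixP => i' j'; rewrite !mxE !coord_free ?(basis_free (vbasisP _)) //.
by rewrite -natrM mulnb [i == _]eq_sym [j == _]eq_sym.
Qed.

Definition tens_map (K : fieldType) (V W V' W' : vectType K)
    (f : 'Hom(V, V')) (g : 'Hom(W, W')) : 'Hom(tensor V W, tensor V' W') :=
  tens_lift (fun v w => tens (f v) (g w)).

Lemma tens_mapE (K : fieldType) (V W V' W' : vectType K)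
    (f : 'Hom(V, V')) (g : 'Hom(W, W')) v w :
  tens_map f g (tens v w) = tens (f v) (g w).
Proof.
apply: (@tens_liftE K V W _ (fun v w => tens (f v) (g w))) => [w'|v'] s x y.
  by rewrite linearP /= tens_linearl.
by rewrite linearP /= tens_linearr.
Qed.

Definition orthonormal_basis (R : realType) (n : nat)
    (b : n.-tuple 'rV[R]_n) : Prop :=
  basis_of fullv b /\
  forall i j : 'I_n, (b`_i *m (b`_j)^T) 0 0 = (i == j)%:R.

Definition not_map (K : fieldType) (S : vectType K) (top bot : S) :
    'Hom(S, S) :=
  lin_ext [tuple top; bot] (fun i => if [:: top; bot]`_i == top then bot else top).

Definition tens_basis (K : fieldType) (S : vectType K) (top bot : S) :
    4.-tuple (tensor S S) :=
  [tuple tens top top; tens top bot; tens bot top; tens bot bot].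

Definition and_map (K : fieldType) (S : vectType K) (top bot : S) :
    'Hom(tensor S S, S) :=
  lin_ext (tens_basis top bot)
    (fun i => if (tens_basis top bot)`_i == tens top top then top else bot).

Definition or_map (K : fieldType) (S : vectType K) (top bot : S) :
    'Hom(tensor S S, S) :=
  lin_ext (tens_basis top bot)
    (fun i => if (tens_basis top bot)`_i == tens bot bot then bot else top).

Definition ifthen_map (K : fieldType) (S : vectType K) (top bot : S) :
    'Hom(tensor S S, S) :=
  lin_ext (tens_basis top bot)
    (fun i => if (tens_basis top bot)`_i == tens top bot then bot else top).

Lemma not_mapE (K : fieldType) (S : vectType K) (top bot : S) :
    basis_of fullv [:: top; bot] ->
  not_map top bot top = bot /\ not_map top bot bot = top.
Proof.
move=> /basis_free fr.
have ntb : bot != top.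
  by have := free_uniq fr; rewrite /= inE andbT eq_sym.
have fr' : free [tuple top; bot] by [].
split.
  by rewrite (lin_extE _ (0 : 'I_2) fr') /= eqxx.
by rewrite (lin_extE _ (1 : 'I_2) fr') /= (negPf ntb).
Qed.

Lemma tens_basis_free (K : fieldType) (S : vectType K) (top bot : S) :
  basis_of fullv [:: top; bot] -> free (tens_basis top bot).
Proof.
move=> /basis_free fr; have fr' : free [tuple top; bot] by [].
pose B : 2.-tuple S := [tuple top; bot].
pose beta (i j : 'I_2) (v w : S) : K^o := coord B i v * coord B j w.
have bE i j v w : tens_lift (beta i j) (tens v w) = beta i j v w.
  apply: tens_liftE => u s x y; rewrite /beta linearP /=.
    by rewrite mulrDl -mulrA.
  by rewrite mulrDr mulrCA.
have cE (i j : 'I_2) : coord B j B`_i = (i == j)%:R by apply: coord_free.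
have cT j : coord B j top = (0 == j)%:R by apply: (cE 0).
have cF j : coord B j bot = (1 == j)%:R by apply: (cE 1).
apply/freeP => k; rewrite !big_ord_recl big_ord0 /= => H.
have key i j : tens_lift (beta i j) 0 = 0 by rewrite linear0.
move: (key 0 0) (key 0 1) (key 1 0) (key 1 1); rewrite -H.
rewrite !linearD !linearZ !linear0 /= !bE /beta !cT !cF /=.
rewrite !(mulr1, mulr0, mul0r, scaler0, addr0, add0r) /=.
rewrite /GRing.scale /= !mulr1 => h0 h1 h2 h3 i.
case: i => [[|[|[|[|//]]]] lt]; [rewrite -h0|rewrite -h1|rewrite -h2|rewrite -h3];
  by congr k; apply: val_inj.
Qed.

Lemma tens_basis_uniq (K : fieldType) (S : vectType K) (top bot : S) :
  basis_of fullv [:: top; bot] -> uniq (tens_basis top bot).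
Proof. by move=> /tens_basis_free/free_uniq. Qed.

Lemma tens_basisP (K : fieldType) (S : vectType K) (top bot : S) :
  basis_of fullv [:: top; bot] -> basis_of fullv (tens_basis top bot).
Proof.
move=> bas; rewrite basisEfree tens_basis_free // subvf /=.
have d2 : \dim {:S} = 2 by apply: (@size_basis _ _ _ 2 [tuple top; bot]).
by rewrite dimvf /dim /= !d2.
Qed.

Lemma tens_lin_ext (K : fieldType) (S : vectType K) (top bot : S)
    (f : tensor S S -> S) (x y : bool) :
    basis_of fullv [:: top; bot] ->
    let z := tens (if x then top else bot) (if y then top else bot) in
  lin_ext (tens_basis top bot) (fun i => f (tens_basis top bot)`_i) z = f z.
Proof.
move=> /tens_basis_free fr; case: x; case: y => /=.
- exact: (lin_extE _ (@Ordinal 4 0 isT) fr).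
- exact: (lin_extE _ (@Ordinal 4 1 isT) fr).
- exact: (lin_extE _ (@Ordinal 4 2 isT) fr).
- exact: (lin_extE _ (@Ordinal 4 3 isT) fr).
Qed.

Lemma tens_eqE (K : fieldType) (S : vectType K) (top bot : S)
    (x y x' y' : bool) :
    basis_of fullv [:: top; bot] ->
    let val b := if b then top else bot in
  (tens (val x) (val y) == tens (val x') (val y')) = ((x, y) == (x', y')).
Proof.
move=> /tens_basis_uniq/=; rewrite !inE !negb_or -!andbA.
case/and4P => h01 h02 h03 /and4P[h12 h13 h23 _].
by case: x; case: y; case: x'; case: y'; rewrite /= ?eqxx //;
  apply/negbTE => //; rewrite eq_sym.
Qed.

Lemma and_mapE (K : fieldType) (S : vectType K) (top bot : S) (x y : bool) :
    basis_of fullv [:: top; bot] ->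
    let val b := if b then top else bot in
  and_map top bot (tens (val x) (val y)) = val (x && y).
Proof.
move=> bas val; rewrite /and_map.
rewrite (tens_lin_ext (fun z => if z == tens top top then top else bot) _ _ bas).
by rewrite (tens_eqE x y true true bas); case: x; case: y.
Qed.

Lemma or_mapE (K : fieldType) (S : vectType K) (top bot : S) (x y : bool) :
    basis_of fullv [:: top; bot] ->
    let val b := if b then top else bot in
  or_map top bot (tens (val x) (val y)) = val (x || y).
Proof.
move=> bas val; rewrite /or_map.
rewrite (tens_lin_ext (fun z => if z == tens bot bot then bot else top) _ _ bas).
by rewrite (tens_eqE x y false false bas); case: x; case: y.
Qed.

Lemma ifthen_mapE (K : fieldType) (S : vectType K) (top bot : S) (x y : bool) :
    basis_of fullv [:: top; bot] ->
    let val b := if b then top else bot in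
  ifthen_map top bot (tens (val x) (val y)) = val (x ==> y).
Proof.
move=> bas val; rewrite /ifthen_map.
rewrite (tens_lin_ext (fun z => if z == tens top bot then bot else top) _ _ bas).
by rewrite (tens_eqE x y true false bas); case: x; case: y.
Qed.

Definition is_predicate (R : realType) (n : nat) (a : n.-tuple 'rV[R]_n)
    (S : vectType R) (top bot : S) (p : 'Hom('rV[R]_n, S)) : Prop :=
  forall i : 'I_n, p a`_i \in [:: top; bot].

Definition true_pred (R : realType) (n : nat) (a : n.-tuple 'rV[R]_n)
    (S : vectType R) (top : S) : 'Hom('rV[R]_n, S) :=
  lin_ext a (fun=> top).

Definition diag_map (R : realType) (n : nat) (a : n.-tuple 'rV[R]_n) :
    'Hom('rV[R]_n, tensor 'rV[R]_n 'rV[R]_n) :=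
  lin_ext a (fun i => tens a`_i a`_i).

Definition pred_pair (R : realType) (n : nat) (a : n.-tuple 'rV[R]_n)
    (S : vectType R) (p q : 'Hom('rV[R]_n, S)) :
    'Hom('rV[R]_n, tensor S S) :=
  (tens_map p q \o diag_map a)%VF.

(* The block C_j of the partition of A is given by its set of indices, i.e.  *)
(* it stands for {a_i | i \in C j}.  Injectivity of C is needed because      *)
(* partition only sees the unindexed family of blocks.                       *)
Definition block_partition (n k : nat) (C : 'I_k -> {set 'I_n}) : Prop :=
  injective C /\ partition [set C j | j : 'I_k] [set: 'I_n].

Definition J (R : realType) (n k : nat) (a : n.-tuple 'rV[R]_n)
    (S : vectType R) (top : S) (C : 'I_k -> {set 'I_n})
    (c : k.-tuple 'rV[R]_k) (p : 'Hom('rV[R]_n, S)) : 'rV[R]_k :=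
  \sum_(j < k)
    (#|[set i in C j | p a`_i == top]|%:R / #|C j|%:R) *: c`_j.

Definition alg_not (R : realType) (x : R) : R := 1 - x.
Definition alg_and (R : realType) (x y : R) : R := x * y.
Definition alg_or (R : realType) (x y : R) : R := x + y - x * y.
Definition alg_imp (R : realType) (x y : R) : R := 1 - x + x * y.

Definition vec_not (R : realType) (k : nat) (c : k.-tuple 'rV[R]_k)
    (X : 'rV[R]_k) : 'rV[R]_k :=
  \sum_(j < k) alg_not (coord c j X) *: c`_j.
Definition vec_and (R : realType) (k : nat) (c : k.-tuple 'rV[R]_k)
    (X Y : 'rV[R]_k) : 'rV[R]_k :=
  \sum_(j < k) alg_and (coord c j X) (coord c j Y) *: c`_j.
Definition vec_or (R : realType) (k : nat) (c : k.-tuple 'rV[R]_k)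
    (X Y : 'rV[R]_k) : 'rV[R]_k :=
  \sum_(j < k) alg_or (coord c j X) (coord c j Y) *: c`_j.
Definition vec_imp (R : realType) (k : nat) (c : k.-tuple 'rV[R]_k)
    (X Y : 'rV[R]_k) : 'rV[R]_k :=
  \sum_(j < k) alg_imp (coord c j X) (coord c j Y) *: c`_j.

Definition vec_one (R : realType) (k : nat) (c : k.-tuple 'rV[R]_k) :
    'rV[R]_k :=
  \sum_(j < k) c`_j.

Definition alg_consequence (R : realType) (k : nat) (c : k.-tuple 'rV[R]_k)
    (X Y : 'rV[R]_k) : Prop :=
  vec_imp c X Y = vec_one c.

(* Main.v *)
(* Coordinatewise, X -> Y = 1 says x (1 - y) = 0, so on every block either x = 0
   or y = 1: either no element of the block satisfies p, or all of them satisfy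
   q.  Hence p implies q pointwise, and on each block one of the two predicates
   is constant, in which case proportions of true elements behave as products. *)

Require Import Defs.
From HB Require Import structures.
From mathcomp Require Import all_boot all_order all_algebra.
From mathcomp Require Import reals.
From mathcomp Require Import ring.

Set Implicit Arguments.
Unset Strict Implicit.
Unset Printing Implicit Defensive.

Import Order.TTheory GRing.Theory Num.Theory.
Local Open Scope ring_scope.

(** * Relative frequencies on a single block *)

Lemma alg_imp_eq1 (R : realType) (x y : R) : alg_imp x y = 1 -> x = 0 \/ y = 1.
Proof.
have -> : alg_imp x y = 1 - x * (1 - y) by rewrite /alg_imp; ring.
move/eqP; rewrite -subr_eq0 addrAC subrr add0r oppr_eq0.
by rewrite mulf_eq0 subr_eq0 => /orP[/eqP|/eqP <-]; [left | right].
Qed.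

(** With [A] a block, this is a coordinate of [J]; working over any finite set removes the linear
    algebra. On an empty [A] the quotient is 0, whence the nonemptiness assumption below. *)
Definition frequency (R : realType) (T : finType) (A : {set T}) (P : pred T) :
    R :=
  #|[set i in A | P i]|%:R / #|A|%:R.

Section Frequency.

Variables (R : realType) (T : finType) (A : {set T}).
Hypothesis A_neq0 : A != set0.

Local Notation freq := (frequency R A).

Let cardA_neq0 : #|A|%:R != 0 :> R.
Proof. by rewrite pnatr_eq0 cards_eq0. Qed.

Lemma eq_frequency (P Q : pred T) : {in A, P =1 Q} -> freq P = freq Q.
Proof.
move=> PQ; rewrite /frequency; congr (#|pred_of_set _|%:R / _).
by apply/setP => i; rewrite !inE; have [/PQ ->|] := boolP (i \in A).
Qed.

Lemma frequency0 : freq xpred0 = 0.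
Proof.
rewrite /frequency [X in #|pred_of_set X|](_ : _ = set0) ?cards0 ?mul0r //.
by apply/setP => i; rewrite !inE andbF.
Qed.

Lemma frequencyC (P : pred T) : freq (predC P) = 1 - freq P.
Proof.
rewrite /frequency -[X in X - _](divff cardA_neq0) -mulrBl; congr (_ / _).
(* [A] splits into the elements that satisfy [P] and those that do not. *)
rewrite -[in RHS](cardsID [set i | P i] A) natrD addrAC.
rewrite [A :&: _](_ : _ = [set i in A | P i]) ?subrr ?add0r; last first.
  by apply/setP => i; rewrite !inE.
by congr (_%:R); apply: eq_card => i; rewrite !inE andbC.
Qed.

Lemma frequency1 : freq xpredT = 1.
Proof. by rewrite -[RHS]subr0 -frequency0 -frequencyC; apply: eq_frequency. Qed.

Lemma frequency_eq0 (P : pred T) : freq P = 0 -> {in A, P =1 xpred0}.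
Proof.
move/eqP; rewrite mulf_eq0 invr_eq0 (negPf cardA_neq0) orbF pnatr_eq0.
by rewrite cards_eq0 => /eqP/setP P0 i iA; have := P0 i; rewrite !inE iA.
Qed.

Lemma frequency_eq1 (P : pred T) : freq P = 1 -> {in A, P =1 xpredT}.
Proof.
move=> P1 i iA; apply/negbFE; apply: (@frequency_eq0 (predC P)) => //.
by rewrite frequencyC P1 subrr.
Qed.

Section Consequence.

Variables P Q : pred T.
Hypothesis PQ1 : alg_imp (freq P) (freq Q) = 1.

(** Frequencies 0 and 1 are attained only by constant predicates; this is the case split behind the
    formulas below. *)
Lemma frequency_constant : {in A, P =1 xpred0} \/ {in A, Q =1 xpredT}.
Proof.
by have [/frequency_eq0|/frequency_eq1] := alg_imp_eq1 PQ1; [left | right].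
Qed.

Lemma frequency_sub : {in A, forall i, P i -> Q i}.
Proof.
by move=> i iA; have [/(_ i iA) -> | /(_ i iA) ->] := frequency_constant.
Qed.

(** If [P] fails on all of [A], both sides are 0; if [Q] holds on all of [A], both are the frequency
    of [P]. *)
Lemma frequency_and :
  freq (fun i => P i && Q i) = alg_and (freq P) (freq Q).
Proof.
rewrite /alg_and; have [P0|Q1] := frequency_constant.
  rewrite (eq_frequency P0) frequency0 mul0r -frequency0.
  by apply: eq_frequency => i /P0 ->.
rewrite (eq_frequency Q1) frequency1 mulr1.
by apply: eq_frequency => i /Q1 ->; rewrite andbT.
Qed.

(** In the two cases both sides are the frequency of [Q] and 1, respectively. *)
Lemma frequency_or : freq (fun i => P i || Q i) = alg_or (freq P) (freq Q).
Proof.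
rewrite /alg_or; have [P0|Q1] := frequency_constant.
  rewrite (eq_frequency P0) frequency0 mul0r add0r subr0.
  by apply: eq_frequency => i /P0 ->.
rewrite (eq_frequency Q1) frequency1 mulr1 addrAC subrr add0r -frequency1.
by apply: eq_frequency => i /Q1 ->; rewrite orbT.
Qed.

Lemma frequency_imp : freq (fun i => P i ==> Q i) = alg_imp (freq P) (freq Q).
Proof.
rewrite PQ1 -frequency1; apply: eq_frequency => i iA.
exact/implyP/frequency_sub.
Qed.

(** The hypothesis still concerns [P] to [Q]: if [P] is constantly false, the reverse implication is
    the negation of [Q]; if [Q] is constantly true, it is [P]. *)
Lemma frequency_imp_converse :
  freq (fun i => Q i ==> P i) = alg_imp (freq Q) (freq P).
Proof.
rewrite /alg_imp; have [P0|Q1] := frequency_constant.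
  rewrite (eq_frequency P0) frequency0 mulr0 addr0 -frequencyC.
  by apply: eq_frequency => i /P0 -> /=; rewrite implybF.
rewrite (eq_frequency Q1) frequency1 mul1r subrr add0r.
by apply: eq_frequency => i /Q1 ->.
Qed.

End Consequence.

End Frequency.

(** * Blocks of the partition and coordinates with respect to [c] *)

Lemma block_neq0 (n k : nat) (C : 'I_k -> {set 'I_n}) (j : 'I_k) :
  block_partition C -> C j != set0.
Proof.
case=> _ /and3P[_ _]; apply: contraNneq => <-; exact: imset_f.
Qed.

Lemma block_cover (n k : nat) (C : 'I_k -> {set 'I_n}) (i : 'I_n) :
  block_partition C -> exists j, i \in C j.
Proof.
case=> _ /and3P[/eqP covC _ _]; have : i \in cover [set C j | j : 'I_k].
  by rewrite covC inE.
by case/bigcupP => _ /imsetP[j _ ->] iCj; exists j.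
Qed.

Lemma coord_sum_basis (R : realType) (k : nat) (c : k.-tuple 'rV[R]_k)
    (x : 'I_k -> R) (j : 'I_k) :
  orthonormal_basis c -> coord c j (\sum_(i < k) x i *: c`_i) = x j.
Proof. by case=> /basis_free fr _; rewrite coord_sum_free. Qed.

Lemma vec_imp_eq1 (R : realType) (k : nat) (c : k.-tuple 'rV[R]_k)
    (X Y : 'rV[R]_k) (j : 'I_k) :
    orthonormal_basis c -> vec_imp c X Y = vec_one c ->
  alg_imp (coord c j X) (coord c j Y) = 1.
Proof.
move=> hc /(congr1 (coord c j)); rewrite /vec_imp coord_sum_basis // => ->.
rewrite /vec_one (eq_bigr (fun i : 'I_k => 1 *: c`_i)) ?coord_sum_basis //.
by move=> i _; rewrite scale1r.
Qed.

(** * Truth values of predicates on basis vectors *)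

Section Predicates.

Variables (R : realType) (n : nat) (a : n.-tuple 'rV[R]_n).
Variables (S : vectType R) (top bot : S).
Hypothesis hTB : basis_of fullv [:: top; bot].

Local Notation val b := (if b then top else bot).

Lemma bot_neq_top : bot != top.
Proof. by have /basis_free/free_uniq := hTB; rewrite /= inE andbT eq_sym. Qed.

Lemma truth_value_eq_top (b : bool) : (val b == top) = b.
Proof. by case: b; rewrite ?eqxx // (negPf bot_neq_top). Qed.

(** Encodes the value of a predicate as a boolean, so that linear connectives reduce to boolean
    ones. *)
Lemma predicateE (p : 'Hom('rV[R]_n, S)) (i : 'I_n) :
  is_predicate a top bot p -> p a`_i = val (p a`_i == top).
Proof.
move=> /(_ i); rewrite !inE => /orP[]/eqP ->; first by rewrite eqxx.
by rewrite (negPf bot_neq_top).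
Qed.

Lemma not_predE (p : 'Hom('rV[R]_n, S)) (i : 'I_n) :
    is_predicate a top bot p ->
  ((not_map top bot \o p)%VF a`_i == top) = (p a`_i != top).
Proof.
move=> /(predicateE i) pE; have [nT nB] := not_mapE hTB.
rewrite comp_lfunE pE.
by case: ifP; rewrite ?nT ?nB ?eqxx // (negPf bot_neq_top).
Qed.

Lemma pred_pairE (p q : 'Hom('rV[R]_n, S)) (i : 'I_n) :
  basis_of fullv a -> pred_pair a p q a`_i = tens (p a`_i) (q a`_i).
Proof.
move=> /basis_free fr.
by rewrite /pred_pair comp_lfunE /diag_map lin_extE // tens_mapE.
Qed.

(** The diagonal sends a basis vector to its tensor square, so [f] receives the tensor of the two
    truth values. Stated for any [op] to serve conjunction, disjunction and implication alike. *)
Lemma connective_predE (f : 'Hom(tensor S S, S)) (op : bool -> bool -> bool)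
    (p q : 'Hom('rV[R]_n, S)) (i : 'I_n) :
    basis_of fullv a ->
    (forall x y, f (tens (val x) (val y)) = val (op x y)) ->
    is_predicate a top bot p -> is_predicate a top bot q ->
  ((f \o pred_pair a p q)%VF a`_i == top) = op (p a`_i == top) (q a`_i == top).
Proof.
move=> ba fE /(predicateE i) pE /(predicateE i) qE.
by rewrite comp_lfunE pred_pairE // pE qE fE !truth_value_eq_top.
Qed.

End Predicates.

Theorem theorem1 (R : realType) (n k : nat)
    (a : n.-tuple 'rV[R]_n) (ha : orthonormal_basis a)
    (S : vectType R) (hS : \dim {: S} = 2%N)
    (top bot : S) (hTB : basis_of fullv [:: top; bot])
    (C : 'I_k -> {set 'I_n}) (hC : block_partition C)
    (c : k.-tuple 'rV[R]_k) (hc : orthonormal_basis c)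
    (p q : 'Hom('rV[R]_n, S))
    (hp : is_predicate a top bot p) (hq : is_predicate a top bot q) :
  [/\ J a top C c (not_map top bot \o p)%VF = vec_not c (J a top C c p),
      vec_imp c (J a top C c p) (J a top C c q) = vec_one c ->
        (ifthen_map top bot \o pred_pair a p q)%VF = true_pred a top
    & alg_consequence c (J a top C c p) (J a top C c q) \/
      alg_consequence c (J a top C c q) (J a top C c p) ->
      [/\ vec_and c (J a top C c p) (J a top C c q)
            = J a top C c (and_map top bot \o pred_pair a p q)%VF,
          vec_or c (J a top C c p) (J a top C c q)
            = J a top C c (or_map top bot \o pred_pair a p q)%VF,
          vec_imp c (J a top C c p) (J a top C c q)
            = J a top C c (ifthen_map top bot \o pred_pair a p q)%VF
        & vec_imp c (J a top C c q) (J a top C c p)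
            = J a top C c (ifthen_map top bot \o pred_pair a q p)%VF]].
Proof.
case: (ha) => ba _.
have C0 j : C j != set0 by apply: block_neq0.
have coordJ r j : coord c j (J a top C c r)
    = frequency R (C j) (fun i => r a`_i == top).
  by rewrite /J coord_sum_basis.
(* Reduces each identity between vectors to a boolean description of [r] on basis vectors and a
   frequency computation on each block. *)
have freqJ (r : 'Hom('rV[R]_n, S)) (U : pred 'I_n) (x : 'I_k -> R) :
    (forall i : 'I_n, (r a`_i == top) = U i) ->
    (forall j, frequency R (C j) U = x j) ->
    J a top C c r = \sum_(j < k) x j *: c`_j.
  move=> rU Ux; apply: eq_bigr => j _; rewrite -Ux; congr (_ *: _).
  by apply: eq_frequency => i _; apply: rU.
have andE x y := and_mapE x y hTB.
have orE x y := or_mapE x y hTB.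
have impE x y := ifthen_mapE x y hTB.
have cPQ r s (j : 'I_k) :
    vec_imp c (J a top C c r) (J a top C c s) = vec_one c ->
    alg_imp (frequency R (C j) (fun i => r a`_i == top))
            (frequency R (C j) (fun i => s a`_i == top)) = 1.
  by move=> /(vec_imp_eq1 j hc); rewrite !coordJ.
split=> [|pq1|pq1].
- apply: (freqJ _ (fun i => p a`_i != top)) => [i|j]; first exact: not_predE.
  by rewrite coordJ frequencyC.
(* By linearity it suffices to compare the two maps on the basis [a]. *)
- apply/lfunP => v; rewrite (coord_basis ba (memvf v)) !linear_sum /=.
  apply: eq_bigr => i _; rewrite !linearZ; congr (_ *: _).
  rewrite [RHS]lin_extE ?(basis_free ba) //.
  apply/eqP; rewrite (connective_predE hTB _ ba impE hp hq); apply/implyP.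
  (* The pointwise implication is read off in the block containing the index [i]. *)
  have [j iCj] := block_cover i hC.
  exact: (frequency_sub (C0 j) (cPQ _ _ j pq1) iCj).
- split; apply/esym.
  + apply: freqJ => [i|j]; first exact: connective_predE ba andE hp hq.
    rewrite !coordJ; case: pq1 => /(cPQ _ _ j) h;
      first exact: (frequency_and (C0 j) h).
    (* Here [p] follows from [q]; both conjunctions are symmetric, so the roles are exchanged. *)
    rewrite /alg_and mulrC -[RHS](frequency_and (C0 j) h).
    by apply: eq_frequency => i _; rewrite andbC.
  + apply: freqJ => [i|j]; first exact: connective_predE ba orE hp hq.
    rewrite !coordJ; case: pq1 => /(cPQ _ _ j) h;
      first exact: (frequency_or (C0 j) h).
    rewrite /alg_or mulrC [X in X - _]addrC -[RHS](frequency_or (C0 j) h).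
    by apply: eq_frequency => i _; rewrite orbC.
  + apply: freqJ => [i|j]; first exact: connective_predE ba impE hp hq.
    rewrite !coordJ; case: pq1 => /(cPQ _ _ j) h;
      first exact: (frequency_imp (C0 j) h).
    (* Implication is not symmetric: with [p] a consequence of [q], the implication from [p] to [q]
       is the converse one. *)
    exact: (frequency_imp_converse (C0 j) h).
  + apply: freqJ => [i|j]; first exact: connective_predE ba impE hq hp.
    rewrite !coordJ; case: pq1 => /(cPQ _ _ j) h;
      last exact: (frequency_imp (C0 j) h).
    exact: (frequency_imp_converse (C0 j) h).
Qed.
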